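(* Let $\mathcal{X} \in \mathbb{C}^{I_1 \times \cdots \times I_M \times J_1 \times \cdots \times J_N }$, $\mathcal{A} \in \mathbb{C}^{K_1 \times \cdots \times K_L \times I_1 \times \cdots \times I_M}$ and $\mathcal{B} \in \mathbb{C}^{J_1 \times \cdots \times J_N \times H_1 \times \cdots \times H_R}$. Then $$\mathcal{X}^\dagger = \mathcal{B}*_R(\mathcal{A}*_M\mathcal{X}*_N\mathcal{B})^\dagger *_L\mathcal{A}$$ if and only if $\mathcal{X} = \mathcal{A}^\dagger *_L \mathcal{A}*_M\mathcal{X} =\mathcal{X}*_N\mathcal{B}*_R\mathcal{B}^\dagger$ and both $$\mathcal{K} = \mathcal{A}^\dagger *_L (\mathcal{A}*_M\mathcal{X})*_N(\mathcal{A}*_M\mathcal{X})^\dagger *_L \mathcal{A}\quad\text{and}\quad \mathcal{L} = \mathcal{B}*_R (\mathcal{X}*_N \mathcal{B})^\dagger *_M(\mathcal{X}*_N \mathcal{B})*_R \mathcal{B}^\dagger$$ are Hermitian.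
   Context: Einstein product: for $\mathcal{A}\in\mathbb{C}^{I_1\times\cdots\times I_M\times J_1\times\cdots\times J_N}$ and $\mathcal{B}\in\mathbb{C}^{J_1\times\cdots\times J_N\times K_1\times\cdots\times K_L}$, $(\mathcal{A}*_N\mathcal{B})_{i_1\ldots i_Mk_1\ldots k_L}=\sum_{j_1,\ldots,j_N}a_{i_1\ldots i_Mj_1\ldots j_N}b_{j_1\ldots j_Nk_1\ldots k_L}$ (the subscript is the number of contracted indices; similarly $*_M,*_L,*_R$). The conjugate transpose $\mathcal{A}^*$ has entries $(\mathcal{A}^* )_{j_1\ldots j_Ni_1\ldots i_M}=\overline{a_{i_1\ldots i_Mj_1\ldots j_N}}$; a tensor is Hermitian if it equals its conjugate transpose. The Moore-Penrose inverse $\mathcal{A}^\dagger$ of $\mathcal{A}\in\mathbb{C}^{I_1\times\cdots\times I_M\times J_1\times\cdots\times J_N}$ is the unique tensor $\mathcal{Y}\in\mathbb{C}^{J_1\times\cdots\times J_N\times I_1\times\cdots\times I_M}$ with $\mathcal{A}*_N\mathcal{Y}*_M\mathcal{A}=\mathcal{A}$, $\mathcal{Y}*_M\mathcal{A}*_N\mathcal{Y}=\mathcal{Y}$, $(\mathcal{A}*_N\mathcal{Y})^*=\mathcal{A}*_N\mathcal{Y}$, $(\mathcal{Y}*_M\mathcal{A})^*=\mathcal{Y}*_M\mathcal{A}$. *)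

(* Defs.v *)
From HB Require Import structures.
From mathcomp Require Import all_boot all_order all_algebra.
From mathcomp Require Export reals complex.
Set Implicit Arguments.
Unset Strict Implicit.
Unset Printing Implicit Defensive.
Import Order.TTheory GRing.Theory Num.Theory.
Local Open Scope ring_scope.

(* Multi-indices (i_1, ..., i_M) with 0 <= i_m < I_m, indices counted from 0. *)
Definition midx (M : nat) (I : 'I_M -> nat) : finType :=
  {dffun forall m : 'I_M, 'I_(I m)}.

(* An order M + N tensor of C^{I_1 x ... x I_M x J_1 x ... x J_N}: the first M
   and the last N indices are kept apart, since the conjugate transpose and the
   Moore-Penrose inverse depend on where the list of modes is split. *)
Definition tensor (C : numClosedFieldType) (M N : nat) (I : 'I_M -> nat)
    (J : 'I_N -> nat) : choiceType :=
  {ffun midx I * midx J -> C}.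

(* The number N of contracted indices is explicit, as in the notation *_N. *)
Definition einstein (C : numClosedFieldType) (M N L : nat) (I : 'I_M -> nat)
    (J : 'I_N -> nat) (K : 'I_L -> nat)
    (A : tensor C I J) (B : tensor C J K) : tensor C I K :=
  [ffun p : midx I * midx K => \sum_(j : midx J) A (p.1, j) * B (j, p.2)].

Notation "A *_[ N ] B" := (@einstein _ _ N _ _ _ _ A B)
  (at level 40, left associativity, format "A  *_[ N ]  B") : ring_scope.

Definition conjtr (C : numClosedFieldType) (M N : nat) (I : 'I_M -> nat)
    (J : 'I_N -> nat) (A : tensor C I J) : tensor C J I :=
  [ffun p : midx J * midx I => Num.conj (A (p.2, p.1))].

Notation "A ^H" := (conjtr A) (at level 2, format "A ^H") : ring_scope.

Definition is_hermitian (C : numClosedFieldType) (M : nat) (I : 'I_M -> nat)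
    (A : tensor C I I) : bool := A^H == A.

Definition is_mpinv (C : numClosedFieldType) (M N : nat) (I : 'I_M -> nat)
    (J : 'I_N -> nat) (A : tensor C I J) (Y : tensor C J I) : bool :=
  [&& A *_[N] Y *_[M] A == A,
      Y *_[M] A *_[N] Y == Y,
      is_hermitian (A *_[N] Y)
    & is_hermitian (Y *_[M] A)].

Section Existence.
Variable C : numClosedFieldType.

Local Notation "A ^tC" := ((map_mx Num.conj A)^T) (at level 2).

Let tCM m n p (A : 'M[C]_(m, n)) (B : 'M[C]_(n, p)) :
  (A *m B)^tC = B^tC *m A^tC.
Proof. by rewrite map_mxM trmx_mul. Qed.

Let tCK m n (A : 'M[C]_(m, n)) : (A^tC)^tC = A.
Proof. by apply/matrixP=> i j; rewrite !mxE conjCK. Qed.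

Let tC1 n : (1%:M : 'M[C]_n)^tC = 1%:M.
Proof. by rewrite map_mx1 trmx1. Qed.

Let gram_eq0 n (v : 'rV[C]_n) : v *m v^tC = 0 -> v = 0.
Proof.
move=> /matrixP/(_ 0 0); rewrite !mxE => /eqP.
rewrite psumr_eq0 => [/allP h|i _]; last by rewrite !mxE mul_conjC_ge0.
apply/matrixP=> i j; rewrite ord1 !mxE.
have := h j; rewrite mem_index_enum !mxE => /(_ isT).
by rewrite mul_conjC_eq0 => /eqP.
Qed.

Let gram_unit m n (A : 'M[C]_(m, n)) : row_free A -> A *m A^tC \in unitmx.
Proof.
move=> fA; rewrite -row_free_unit; apply: inj_row_free => v.
move=> h; have : (v *m A) *m (v *m A)^tC = 0.
  by rewrite tCM mulmxA -(mulmxA v) h mul0mx.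
by move/gram_eq0; rewrite -(mul0mx _ A) => /(row_free_inj fA).
Qed.

Let mpmx_ex m n (A : 'M[C]_(m, n)) : exists Y : 'M[C]_(n, m),
  [/\ A *m Y *m A = A, Y *m A *m Y = Y,
      (A *m Y)^tC = A *m Y & (Y *m A)^tC = Y *m A].
Proof.
have [r [F [G [fF fG ->]]]] : exists r (F : 'M[C]_(m, r)) (G : 'M[C]_(r, n)),
    [/\ row_full F, row_free G & A = F *m G].
  exists (\rank A), (col_base A), (row_base A).
  by rewrite col_base_full row_base_free mulmx_base.
have uG : G *m G^tC \in unitmx by apply: gram_unit.
have uF : F^tC *m F \in unitmx.
  have /gram_unit : row_free F^tC by rewrite /row_free mxrank_tr mxrank_map.
  by rewrite tCK.
set g := invmx (G *m G^tC); set f := invmx (F^tC *m F).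
have hg : g^tC = g by rewrite map_invmx trmx_inv tCM tCK.
have hf : f^tC = f by rewrite map_invmx trmx_inv tCM tCK.
have GR : G *m (G^tC *m g) = 1%:M by rewrite mulmxA mulmxV.
have FL : (f *m F^tC) *m F = 1%:M by rewrite -mulmxA mulVmx.
exists ((G^tC *m g) *m (f *m F^tC)).
have AY : (F *m G) *m ((G^tC *m g) *m (f *m F^tC)) = F *m (f *m F^tC).
  by rewrite -(mulmxA F) (mulmxA G) GR mul1mx.
have YA : ((G^tC *m g) *m (f *m F^tC)) *m (F *m G) = (G^tC *m g) *m G.
  by rewrite -(mulmxA (G^tC *m g)) (mulmxA (f *m F^tC)) FL mul1mx.
split.
- by rewrite AY -mulmxA (mulmxA (f *m F^tC)) FL mul1mx.
- by rewrite YA -mulmxA (mulmxA G) GR mul1mx.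
- by rewrite AY !tCM tCK hf mulmxA.
- by rewrite YA !tCM tCK hg mulmxA.
Qed.

Let flat M N (I : 'I_M -> nat) (J : 'I_N -> nat) (A : tensor C I J) :
    'M[C]_(#|midx I|, #|midx J|) :=
  \matrix_(i, j) A (enum_val i, enum_val j).

Let flat_inj M N (I : 'I_M -> nat) (J : 'I_N -> nat) :
  injective (@flat M N I J).
Proof.
move=> A B /matrixP h; apply/ffunP=> -[i j].
by have := h (enum_rank i) (enum_rank j); rewrite !mxE !enum_rankK.
Qed.

Let flat_surj M N (I : 'I_M -> nat) (J : 'I_N -> nat)
    (Y : 'M[C]_(#|midx I|, #|midx J|)) :
  exists A : tensor C I J, flat A = Y.
Proof.
exists [ffun p : midx I * midx J => Y (enum_rank p.1) (enum_rank p.2)].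
by apply/matrixP=> i j; rewrite mxE ffunE !enum_valK.
Qed.

Let flatM M N L (I : 'I_M -> nat) (J : 'I_N -> nat) (K : 'I_L -> nat)
    (A : tensor C I J) (B : tensor C J K) :
  flat (A *_[N] B) = flat A *m flat B.
Proof.
apply/matrixP=> i k; rewrite !mxE ffunE /= (reindex (@enum_val _ (midx J))) /=.
  by apply: eq_bigr => j _; rewrite !mxE.
by exists enum_rank => j _; rewrite ?enum_valK ?enum_rankK.
Qed.

Let flatH M N (I : 'I_M -> nat) (J : 'I_N -> nat) (A : tensor C I J) :
  flat A^H = (flat A)^tC.
Proof. by apply/matrixP=> i j; rewrite !mxE ffunE. Qed.

Lemma mpinv_exists M N (I : 'I_M -> nat) (J : 'I_N -> nat)
  (A : tensor C I J) : exists Y, is_mpinv A Y.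
Proof.
have [Z [h1 h2 h3 h4]] := mpmx_ex (flat A).
have [Y YE] := flat_surj Z; rewrite -YE in h1 h2 h3 h4.
exists Y; apply/and4P; split; apply/eqP/flat_inj; rewrite ?flatH !flatM //.
Qed.
End Existence.

Definition mpinv (C : numClosedFieldType) (M N : nat) (I : 'I_M -> nat)
    (J : 'I_N -> nat) (A : tensor C I J) : tensor C J I :=
  xchoose (mpinv_exists A).



Section Uniqueness.
Variable C : numClosedFieldType.

Lemma einsteinA M N L R (I : 'I_M -> nat) (J : 'I_N -> nat) (K : 'I_L -> nat)
    (H : 'I_R -> nat) (A : tensor C I J) (B : tensor C J K) (D : tensor C K H) :
  A *_[N] (B *_[L] D) = A *_[N] B *_[L] D.
Proof.
apply/ffunP=> p; rewrite !ffunE /=.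
under eq_bigr => j _ do rewrite ffunE /= mulr_sumr.
rewrite exchange_big /=; apply: eq_bigr => k _; rewrite ffunE /= mulr_suml.
by apply: eq_bigr => j _; rewrite mulrA.
Qed.

Lemma conjtrM M N L (I : 'I_M -> nat) (J : 'I_N -> nat) (K : 'I_L -> nat)
    (A : tensor C I J) (B : tensor C J K) :
  (A *_[N] B)^H = B^H *_[N] A^H.
Proof.
apply/ffunP=> p; rewrite !ffunE /= rmorph_sum; apply: eq_bigr => j _.
by rewrite !ffunE /= rmorphM mulrC.
Qed.

Lemma mpinvP M N (I : 'I_M -> nat) (J : 'I_N -> nat) (A : tensor C I J) :
  is_mpinv A (mpinv A).
Proof. exact: xchooseP. Qed.

Lemma mpinv_uniq M N (I : 'I_M -> nat) (J : 'I_N -> nat) (A : tensor C I J)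
    (Y : tensor C J I) : is_mpinv A Y -> Y = mpinv A.
Proof.
case/and4P=> /eqP y1 /eqP y2 /eqP y3 /eqP y4.
case/and4P: (mpinvP A); set Z := mpinv A => /eqP z1 /eqP z2 /eqP z3 /eqP z4.
have AYZ : A *_[N] Y = A *_[N] Z.
  rewrite -[LHS]y3 -{1}z1 -(einsteinA (A *_[N] Z)) conjtrM y3 z3.
  by rewrite einsteinA y1.
have YZA : Y *_[M] A = Z *_[M] A.
  rewrite -[LHS]y4 -{1}z1 -(einsteinA A) einsteinA conjtrM y4 z4.
  by rewrite -!einsteinA (einsteinA A) y1.
by rewrite -y2 YZA -einsteinA AYZ einsteinA z2.
Qed.
End Uniqueness.

(* Main.v *)
(** Write P_T = T T^+ and Q_T = T^+ T for the projectors onto the range and the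
    co-range of T, and D = A X B.  If X = A^+ A X = X B B^+, then A X and D have
    the same range and X B and D the same co-range, so that K = A^+ P_D A =
    X (B D^+ A) and L = B Q_D B^+ = (B D^+ A) X.  Hence K and L are Hermitian
    exactly when B D^+ A satisfies the last two Penrose equations; the first two
    always hold for it.  Conversely, X^+ = B D^+ A forces the range of X^* into
    that of B and the range of X into that of A^*, i.e. X = A^+ A X = X B B^+. *)
Require Import Defs.
From mathcomp Require Import all_boot all_order all_algebra.
Local Open Scope ring_scope.
Local Open Scope complex_scope.

Section MoorePenrose.
Set Implicit Arguments.
Unset Strict Implicit.
Variable C : numClosedFieldType.

Section Single.
Variables (M N : nat) (I : 'I_M -> nat) (J : 'I_N -> nat).
Implicit Type T : tensor C I J.

Lemma mpinvK T : T *_[N] mpinv T *_[M] T = T.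
Proof. by case/and4P: (mpinvP T) => /eqP. Qed.

Lemma mpinvVK T : mpinv T *_[M] T *_[N] mpinv T = mpinv T.
Proof. by case/and4P: (mpinvP T) => _ /eqP. Qed.

Lemma conjtr_mulmpinv T : (T *_[N] mpinv T)^H = T *_[N] mpinv T.
Proof. by case/and4P: (mpinvP T) => _ _ /eqP. Qed.

Lemma conjtr_mpinvmul T : (mpinv T *_[M] T)^H = mpinv T *_[M] T.
Proof. by case/and4P: (mpinvP T) => _ _ _ /eqP. Qed.

End Single.

(** Since [T] and [U] are right multiples of each other, they have the same range. Each of the two
    projectors therefore fixes the other, and as both are Hermitian they coincide. *)
Lemma mulmpinv_eq {M N L} {I : 'I_M -> nat} {J : 'I_N -> nat} {K : 'I_L -> nat}
    (T : tensor C I J) (U : tensor C I K) (F : tensor C J K)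
    (G : tensor C K J) :
  U = T *_[N] F -> T = U *_[L] G -> T *_[N] mpinv T = U *_[L] mpinv U.
Proof.
move=> UE TE.
have TU : T *_[N] mpinv T *_[M] (U *_[L] mpinv U) = U *_[L] mpinv U.
  by rewrite einsteinA {1}UE !einsteinA mpinvK -UE.
have UT : U *_[L] mpinv U *_[M] (T *_[N] mpinv T) = T *_[N] mpinv T.
  by rewrite einsteinA {1}TE !einsteinA mpinvK -TE.
by rewrite -[LHS]conjtr_mulmpinv -UT conjtrM !conjtr_mulmpinv TU.
Qed.

Lemma mpinvmul_eq {M N L} {I : 'I_M -> nat} {J : 'I_N -> nat} {K : 'I_L -> nat}
    (T : tensor C I J) (U : tensor C K J) (F : tensor C K I)
    (G : tensor C I K) :
  U = F *_[M] T -> T = G *_[L] U -> mpinv T *_[M] T = mpinv U *_[L] U.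
Proof.
move=> UE TE.
have UT : mpinv U *_[L] U *_[N] (mpinv T *_[M] T) = mpinv U *_[L] U.
  by rewrite {2}UE -!einsteinA (einsteinA T) mpinvK -UE.
have TU : mpinv T *_[M] T *_[N] (mpinv U *_[L] U) = mpinv T *_[M] T.
  by rewrite {2}TE -!einsteinA (einsteinA U) mpinvK -TE.
by rewrite -[LHS]conjtr_mpinvmul -TU conjtrM !conjtr_mpinvmul UT.
Qed.

(** The range of X^+ lies in that of [B], so B B^+ fixes X^+ X. The adjoint of this identity,
    multiplied by [X] on the left, is the claim. *)
Lemma mulmpinv_absorb {M N R} {I : 'I_M -> nat} {J : 'I_N -> nat}
    {H : 'I_R -> nat} (X : tensor C I J) (B : tensor C J H) (W : tensor C H I) :
  mpinv X = B *_[R] W -> X = X *_[N] B *_[R] mpinv B.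
Proof.
move=> XE.
have BX : B *_[R] mpinv B *_[N] (mpinv X *_[M] X) = mpinv X *_[M] X.
  by rewrite XE !einsteinA mpinvK.
have /(congr1 (einstein X)) := congr1 (@conjtr _ _ _ _ _) BX.
by rewrite conjtrM conjtr_mulmpinv conjtr_mpinvmul !einsteinA mpinvK.
Qed.

Lemma mpinvmul_absorb {M N L} {I : 'I_M -> nat} {J : 'I_N -> nat}
    {K : 'I_L -> nat} (X : tensor C I J) (A : tensor C K I) (W : tensor C J K) :
  mpinv X = W *_[L] A -> X = mpinv A *_[L] A *_[M] X.
Proof.
move=> XE.
have XA : X *_[N] mpinv X *_[M] (mpinv A *_[L] A) = X *_[N] mpinv X.
  by rewrite XE -!einsteinA (einsteinA A) mpinvK.
have /(congr1 (fun T => T *_[M] X)) := congr1 (@conjtr _ _ _ _ _) XA.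
rewrite conjtrM conjtr_mulmpinv conjtr_mpinvmul -!einsteinA.
by rewrite (einsteinA X) mpinvK.
Qed.

(* Over Re[i] the same rewriting is very slow, since unification unfolds the
   instances of the complex numbers; hence the abstract C. *)
Lemma mpinv_triple_product {M N L R} {I : 'I_M -> nat} {J : 'I_N -> nat}
    {K : 'I_L -> nat} {H : 'I_R -> nat}
    (X : tensor C I J) (A : tensor C K I) (B : tensor C J H) :
  mpinv X = B *_[R] mpinv (A *_[M] X *_[N] B) *_[L] A
  <->
  [/\ X = mpinv A *_[L] A *_[M] X,
      X = X *_[N] B *_[R] mpinv B,
      is_hermitian (mpinv A *_[L] (A *_[M] X) *_[N] mpinv (A *_[M] X) *_[L] A)
    & is_hermitian (B *_[R] mpinv (X *_[N] B) *_[M] (X *_[N] B) *_[R] mpinv B)].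
Proof.
set D := A *_[M] X *_[N] B; set Y := B *_[R] mpinv D *_[L] A.
have KE : X = mpinv A *_[L] A *_[M] X -> X = X *_[N] B *_[R] mpinv B ->
    mpinv A *_[L] (A *_[M] X) *_[N] mpinv (A *_[M] X) *_[L] A = X *_[N] Y.
  move=> XA XB; rewrite -(einsteinA _ (A *_[M] X)).
  (* A X and D = (A X) B have the same range, because X = X B B^+ gives A X = D B^+. *)
  rewrite (mulmpinv_eq (T := A *_[M] X) (U := D) (F := B) (G := mpinv B)) //.
    by rewrite /D /Y !einsteinA -XA.
  by rewrite {1}XB !einsteinA.
have LE : X = mpinv A *_[L] A *_[M] X -> X = X *_[N] B *_[R] mpinv B ->
    B *_[R] mpinv (X *_[N] B) *_[M] (X *_[N] B) *_[R] mpinv B = Y *_[M] X.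
  move=> XA XB; rewrite -(einsteinA B).
  rewrite (mpinvmul_eq (T := X *_[N] B) (U := D) (F := A) (G := mpinv A)) //.
  - by rewrite /D /Y -!einsteinA (einsteinA X) -XB !einsteinA.
  - by rewrite /D -einsteinA.
  - by rewrite {1}XA /D !einsteinA.
split=> [XE | [XA XB]].
  have XB : X = X *_[N] B *_[R] mpinv B.
    by apply: (mulmpinv_absorb (W := mpinv D *_[L] A)); rewrite einsteinA.
  have XA : X = mpinv A *_[L] A *_[M] X by exact: mpinvmul_absorb XE.
  split=> //; apply/eqP.
    by rewrite KE // -XE conjtr_mulmpinv.
  by rewrite LE // -XE conjtr_mpinvmul.
(* By uniqueness, the four Penrose equations for [Y] suffice; [hK] and [hL] are the last two. *)
rewrite KE // LE // => hK hL; apply/esym/mpinv_uniq; apply/and4P; split=> //.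
  (* X = A^+ D B^+, so X Y X = A^+ (D D^+ D) B^+ = X. *)
  have XD : X = mpinv A *_[L] D *_[R] mpinv B.
    by rewrite /D !einsteinA -XA -XB.
  apply/eqP; rewrite {2}XB {1}XA /Y !einsteinA.
  have := congr1 (fun T => mpinv A *_[L] T *_[R] mpinv B) (mpinvK D).
  by rewrite -XD {1 3}/D !einsteinA.
(* Y X Y = B (D^+ D D^+) A = Y. *)
have := congr1 (fun T => B *_[R] T *_[L] A) (mpinvVK D).
by rewrite {2}/D /Y !einsteinA => ->.
Qed.

End MoorePenrose.

Theorem theorem2 (Re : realType) (M N L R : nat)
  (I : 'I_M -> nat) (J : 'I_N -> nat) (K : 'I_L -> nat) (H : 'I_R -> nat)
  (X : tensor Re[i] I J) (A : tensor Re[i] K I) (B : tensor Re[i] J H) :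
  mpinv X = B *_[R] mpinv (A *_[M] X *_[N] B) *_[L] A
  <->
  [/\ X = mpinv A *_[L] A *_[M] X,
      X = X *_[N] B *_[R] mpinv B,
      is_hermitian (mpinv A *_[L] (A *_[M] X) *_[N] mpinv (A *_[M] X) *_[L] A)
    & is_hermitian (B *_[R] mpinv (X *_[N] B) *_[M] (X *_[N] B) *_[R] mpinv B)].
Proof. exact: mpinv_triple_product. Qed.
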